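(* Along each Kepler orbit of negative energy, the Ligon--Schaaf map $\varphi=R\circ S$ transforms the Kepler flow into a geodesic on $T_1^*S^3$ parametrized by the mean anomaly $M$.
   Context: The Kepler Hamiltonian is $H(q,p)=\frac12|p|^2-|q|^{-1}$ on $\{(q,p)\in\mathbb R^3\times\mathbb R^3: q\ne0\}$; a Kepler orbit is a solution of $\dot q=p$, $\dot p=-q/|q|^3$. Let $\Sigma_-=\{(q,p): q\neq 0,\ H(q,p)<0\}$, $T^*S^3=\{(x,y)\in\mathbb R^4\times\mathbb R^4: |x|=1,\ \langle x,y\rangle=0\}$, and $T_1^*S^3=\{(x,y)\in T^*S^3: |y|=1\}$. Define $S:\Sigma_-\to T_1^*S^3\times\mathbb R_{>0}$ by $S(q,p)=[(r_0,\vec r),(s_0,\vec s),\sqrt{-2H}]$, where $$r_0=|p|^2|q|-1,\quad \vec r=\sqrt{-2H}\,|q|\,p,\quad s_0=-\sqrt{-2H}\,\langle q,p\rangle,\quad \vec s=-\Big(\frac{q}{|q|}-\langle q,p\rangle p\Big).$$ The map $R$ sends $(r,s,\sqrt{-2H})$ (the last entry being the $\mathbb R_{>0}$-component) to $(x,y)$ given by $$\begin{pmatrix}x_0&\vec x\\ y_0&\vec y\end{pmatrix}=\begin{pmatrix}\cos(-s_0)&-\sin(-s_0)\\ \frac{\sin(-s_0)}{\sqrt{-2H}}&\frac{\cos(-s_0)}{\sqrt{-2H}}\end{pmatrix}\begin{pmatrix}r_0&\vec r\\ s_0&\vec s\end{pmatrix}.$$ The Ligon--Schaaf map on $\Sigma_-$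 is $\varphi=R\circ S$. For a bound orbit with semi-major axis $a=-\frac1{2H}$, eccentricity $0\le e<1$ and periapsis at $t=0$, the mean anomaly is $M(t)=a^{-3/2}t$; it is related to the eccentric anomaly $\varepsilon(t)$ by $M=\varepsilon-e\sin\varepsilon$, where $|q|=a(1-e\cos\varepsilon)$.
   Formalization: As defined, φ has cotangent component of norm 1/√(−2H), so its image lies in T_1^*S^3 only if −2H=1; the theorem states φ(q(t),p(t)) = (x(M), y(M)/√(−2H)) with (x,y) a unit-speed geodesic in T_1^*S^3. *)

(* Defs.v *)
From HB Require Import structures.
From mathcomp Require Import all_boot all_order all_algebra.
From mathcomp Require Import all_classical all_reals all_analysis.

Set Implicit Arguments.
Unset Strict Implicit.
Unset Printing Implicit Defensive.

Import Order.TTheory GRing.Theory Num.Theory.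
Import numFieldNormedType.Exports.

Local Open Scope classical_set_scope.
Local Open Scope ring_scope.

(* The norm `|v| of MathComp-Analysis on 'rV[R]_n is the sup norm, hence the
   separate Euclidean structure; the topology, and so derivatives, agree. *)
Definition dot (R : realType) (n : nat) (u v : 'rV[R]_n) : R :=
  \sum_(i < n) u 0 i * v 0 i.

Definition enorm (R : realType) (n : nat) (u : 'rV[R]_n) : R :=
  Num.sqrt (dot u u).

Definition kepler_H (R : realType) (q p : 'rV[R]_3) : R :=
  enorm p ^+ 2 / 2 - (enorm q)^-1.

Definition Sigma_minus (R : realType) : set ('rV[R]_3 * 'rV[R]_3) :=
  [set z | z.1 != 0 /\ kepler_H z.1 z.2 < 0].

Definition kepler_orbit (R : realType) (J : set R) (q p : R -> 'rV[R]_3) : Prop :=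
  [/\ open J, is_interval J &
      forall t, J t ->
        [/\ q t != 0,
            is_derive t 1 q (p t) &
            is_derive t 1 p (- ((enorm (q t) ^+ 3)^-1 *: q t))]].

Definition kepler_nu (R : realType) (q p : 'rV[R]_3) : R :=
  Num.sqrt (- (2 * kepler_H q p)).

Definition semi_major_axis (R : realType) (q p : 'rV[R]_3) : R :=
  - (2 * kepler_H q p)^-1.

(* Either the orbit is at minimal distance from the origin at time tau, or
   tau is an endpoint of J at which the orbit collides with the origin; the
   second case is that of the orbits with zero angular momentum (e = 1). *)
Definition periapsis_time (R : realType) (J : set R) (q : R -> 'rV[R]_3)
    (tau : R) : Prop :=
  (J tau /\ forall t, J t -> enorm (q tau) <= enorm (q t)) \/
  [/\ ~ J tau, closure J tau &
      enorm (q t) @[t --> within J (nbhs tau)] --> (0 : R)].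

(* tau is the time of periapsis; a is constant along a Kepler orbit. *)
Definition mean_anomaly (R : realType) (tau : R) (q p : R -> 'rV[R]_3)
    (t : R) : R :=
  semi_major_axis (q t) (p t) `^ (- (3 / 2)) * (t - tau).

Definition vec4 (R : realType) (x0 : R) (x : 'rV[R]_3) : 'rV[R]_4 :=
  row_mx (x0%:M : 'M[R]_1) x : 'rV[R]_(1 + 3).

Definition TS3 (R : realType) : set ('rV[R]_4 * 'rV[R]_4) :=
  [set z | enorm z.1 = 1 /\ dot z.1 z.2 = 0].

Definition T1S3 (R : realType) : set ('rV[R]_4 * 'rV[R]_4) :=
  [set z | TS3 z /\ enorm z.2 = 1].

Definition ls_S (R : realType) (q p : 'rV[R]_3) : 'rV[R]_4 * 'rV[R]_4 * R :=
  let nu := kepler_nu q p in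
  (vec4 (enorm p ^+ 2 * enorm q - 1) ((nu * enorm q) *: p),
   vec4 (- (nu * dot q p)) (- ((enorm q)^-1 *: q - dot q p *: p)),
   nu).

Definition ls_R (R : realType) (w : 'rV[R]_4 * 'rV[R]_4 * R) :
    'rV[R]_4 * 'rV[R]_4 :=
  let: (r, s, nu) := w in
  let s0 := s 0 ord0 in
  (cos (- s0) *: r - sin (- s0) *: s,
   (sin (- s0) / nu) *: r + (cos (- s0) / nu) *: s).

Definition ligon_schaaf (R : realType) (q p : 'rV[R]_3) :
    'rV[R]_4 * 'rV[R]_4 := ls_R (ls_S q p).

(* Orthogonal projection of R^4 onto T_x S^3, for |x| = 1. *)
Definition tangent_proj (R : realType) (x v : 'rV[R]_4) : 'rV[R]_4 :=
  v - dot x v *: x.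

(* (x, y) is an orbit of the geodesic flow on T_1^*S^3: covectors are
   identified with tangent vectors by the round metric, whose covariant
   derivative is the tangential part of the derivative in R^4. *)
Definition unit_geodesic (R : realType) (x y : R -> 'rV[R]_4) : Prop :=
  forall u : R,
    [/\ T1S3 (x u, y u),
        is_derive u 1 x (y u),
        derivable y u 1 &
        tangent_proj (x u) ('D_1 y u) = 0].

(* Main.v *)
(* Write rho = |q| and nu = sqrt(-2H). Along the flow, r' = (nu/rho) s and
   s' = -(nu/rho) r, so the orthonormal pair (r, s) turns by the eccentric
   anomaly; moreover s_0' = -nu/rho + nu^3, which is Kepler's equation in
   differential form. The map R turns (r, s) by s_0, so the total angular
   velocity of (x, nu y) is nu^3 = a^(-3/2), that of the mean anomaly M.
   Equivalently, turning (r, s) by s_0 - M gives a constant pair. *)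
Require Import Defs.
From HB Require Import structures.
From mathcomp Require Import all_boot all_order all_algebra.
From mathcomp Require Import ring.
From mathcomp Require Import all_classical all_reals all_analysis.
Import Order.TTheory GRing.Theory Num.Theory.
Import numFieldNormedType.Exports.

Set Implicit Arguments.
Unset Strict Implicit.
Unset Printing Implicit Defensive.

Local Open Scope classical_set_scope.
Local Open Scope ring_scope.

(** * Componentwise calculus for vector-valued functions *)

Lemma is_derive_mxP (R : realFieldType) (V : normedModType R) (m n : nat)
    (M : V -> 'M[R]_(m, n)) (dM : 'M[R]_(m, n)) (t v : V) :
  is_derive t v M dM <->
  forall i j, is_derive t v (fun x => M x i j) (dM i j).
Proof.
split=> [[drv <-] i j|drv].
  split; first exact: (derivable_mxP M t v).1.
  by rewrite derive_mx// mxE.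
have dM' : derivable M t v by apply/derivable_mxP => i j; case: (drv i j).
split=> //; rewrite derive_mx//; apply/matrixP => i j; rewrite mxE.
by case: (drv i j).
Qed.

Lemma is_derive_scalemx (R : realFieldType) (V : normedModType R) (m n : nat)
    (k : V -> R) (dk : R) (M : V -> 'M[R]_(m, n)) (dM : 'M[R]_(m, n))
    (t v : V) :
  is_derive t v k dk -> is_derive t v M dM ->
  is_derive t v (fun x => k x *: M x) (k t *: dM + dk *: M t).
Proof.
move=> dvk /is_derive_mxP dvM; apply/is_derive_mxP => i j.
rewrite (_ : (fun x => _) = k * (fun x => M x i j)); last first.
  by apply/funext => x; rewrite mxE.
apply: is_derive_eq; rewrite !mxE /GRing.scale/=; ring.
Qed.

Lemma is_derive_dot (R : realType) (n : nat) (u v : R -> 'rV[R]_n)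
    (du dv : 'rV[R]_n) (t : R) :
  is_derive t 1 u du -> is_derive t 1 v dv ->
  is_derive t 1 (fun x => dot (u x) (v x)) (dot du (v t) + dot (u t) dv).
Proof.
move=> /is_derive_mxP du' /is_derive_mxP dv'.
rewrite (_ : (fun x => _) =
    \sum_(i < n) (fun x => u x 0 i) * (fun x => v x 0 i)); last first.
  by apply/funext => x; rewrite /dot fct_sumE.
apply: is_derive_eq; rewrite /dot -big_split/=; apply: eq_bigr => i _.
by rewrite /GRing.scale/=; ring.
Qed.

(** The type ['rV_4] hides the splitting 4 = 1 + 3, so entries of [vec4] are addressed through
    explicit [@lshift 1 3] and [@rshift 1 3]. *)
Lemma vec4El (R : realType) (a : R) (u : 'rV[R]_3) (i : 'I_1) (k : 'I_1) :
  vec4 a u i (@lshift 1 3 k) = a.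
Proof.
rewrite !ord1; apply: (etrans (row_mxEl (a%:M : 'M[R]_1) u 0 0)).
by rewrite mxE mulr1n.
Qed.

Lemma vec4Er (R : realType) (a : R) (u : 'rV[R]_3) (i : 'I_1) (k : 'I_3) :
  vec4 a u i (@rshift 1 3 k) = u i k.
Proof. exact: (row_mxEr (a%:M : 'M[R]_1) u). Qed.

Lemma scale_vec4 (R : realType) (k a : R) (u : 'rV[R]_3) :
  k *: vec4 a u = vec4 (k * a) (k *: u).
Proof.
apply/rowP => j; rewrite mxE.
by case: (@split_ordP 1 3 j) => i ->; rewrite ?vec4El ?vec4Er ?mxE.
Qed.

Lemma is_derive_vec4 (R : realType) (f : R -> R) (df : R)
    (u : R -> 'rV[R]_3) (du : 'rV[R]_3) (t : R) :
  is_derive t 1 f df -> is_derive t 1 u du ->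
  is_derive t 1 (fun x => vec4 (f x) (u x)) (vec4 df du).
Proof.
move=> df' /is_derive_mxP du'; apply/is_derive_mxP => i j.
by case: (@split_ordP 1 3 j) => k ->; rewrite ?vec4El ?vec4Er;
  under eq_fun do rewrite ?vec4El ?vec4Er.
Qed.

Lemma dot_vec4 (R : realType) (a b : R) (u v : 'rV[R]_3) :
  dot (vec4 a u) (vec4 b v) = a * b + dot u v.
Proof.
rewrite /dot (@big_split_ord _ _ _ 1 3) big_ord1 !vec4El; congr (_ + _).
by apply: eq_bigr => i _; rewrite !vec4Er.
Qed.

(** * Euclidean geometry of [dot] and [enorm] *)

Section dot_product.
Context {R : realType} {n : nat}.
Implicit Types (u v w : 'rV[R]_n) (a : R).

Lemma dotC u v : dot u v = dot v u.
Proof. by apply: eq_bigr => i _; rewrite mulrC. Qed.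

Lemma dotDl u v w : dot (u + v) w = dot u w + dot v w.
Proof. by rewrite -big_split; apply: eq_bigr => i _; rewrite mxE mulrDl. Qed.

Lemma dotZl a u v : dot (a *: u) v = a * dot u v.
Proof. by rewrite /dot mulr_sumr; apply: eq_bigr => i _; rewrite mxE mulrA. Qed.

Lemma dotNl u v : dot (- u) v = - dot u v.
Proof. by rewrite -scaleN1r dotZl mulN1r. Qed.

Lemma dotDr u v w : dot w (u + v) = dot w u + dot w v.
Proof. by rewrite dotC dotDl !(dotC w). Qed.

Lemma dotZr a u v : dot v (a *: u) = a * dot v u.
Proof. by rewrite dotC dotZl dotC. Qed.

Lemma dotNr u v : dot v (- u) = - dot v u.
Proof. by rewrite dotC dotNl dotC. Qed.

Lemma dot_ge0 u : 0 <= dot u u.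
Proof. by apply: sumr_ge0 => i _; rewrite -expr2 sqr_ge0. Qed.

Lemma sqr_enorm u : enorm u ^+ 2 = dot u u.
Proof. exact/sqr_sqrtr/dot_ge0. Qed.

Lemma dot_gt0 u : u != 0 -> 0 < dot u u.
Proof.
rewrite lt_neqAle dot_ge0 andbT; apply: contra_neq => /esym/eqP.
rewrite psumr_eq0 => [/allP u0|i _]; last by rewrite -expr2 sqr_ge0.
apply/rowP => i; rewrite mxE; apply/eqP.
by have := u0 i (mem_index_enum _); rewrite mulf_eq0 orbb.
Qed.

Lemma enorm_gt0 u : u != 0 -> 0 < enorm u.
Proof. by move=> u0; rewrite sqrtr_gt0 dot_gt0. Qed.

End dot_product.

Lemma is_derive_enorm (R : realType) (n : nat) (u : R -> 'rV[R]_n)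
    (du : 'rV[R]_n) (t : R) :
  u t != 0 -> is_derive t 1 u du ->
  is_derive t 1 (fun x => enorm (u x)) (dot (u t) du / enorm (u t)).
Proof.
move=> u0 du'.
have dd := is_derive_dot du' du'.
have ds := is_derive1_sqrt (dot_gt0 u0).
apply: (is_derive_eq (is_derive1_comp ds dd)).
rewrite (dotC du) -/(enorm (u t)).
have rho0 := lt0r_neq0 (enorm_gt0 u0); by field.
Qed.

(** Mean value theorem on the segment between the two points, which lies in [J] because [J] is an
    interval. *)
Lemma derive0_interval_cst (R : realType) (J : set R) (f : R -> R) :
  is_interval J -> (forall t, J t -> is_derive t 1 f 0) ->
  forall a b, J a -> J b -> f a = f b.
Proof.
move=> Jitv df.
suff H a b : J a -> J b -> a <= b -> f a = f b.
  by move=> a b Ja Jb; have [|/ltW] := leP a b => ?; [exact: H|rewrite (H b a)].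
move=> Ja Jb ab; apply/esym/eqP; rewrite -subr_eq0.
have Jab c : c \in `[a, b] -> J c.
  by rewrite in_itv/= => cab; exact: Jitv cab.
have [x xab||c _ ->] := @MVT_segment _ f (fun=> 0) _ _ ab;
  last by rewrite mul0r.
- by apply: df; apply: Jab; exact: subset_itv_oo_cc.
- by apply: derivable_within_continuous => x /Jab/df[].
Qed.

(** * Rotations of a pair of vectors in the plane they span *)

Section rotation.
Context {R : realType} {n : nat}.
Implicit Types (w : 'rV[R]_n * 'rV[R]_n) (a b : R).

(** This is multiplication of [w.1 - i w.2] by [exp(i a)]; the orientation is such that increasing
    [a] moves [w.1] towards [w.2]. *)
Definition rotate a w : 'rV[R]_n * 'rV[R]_n :=
  (cos a *: w.1 + sin a *: w.2, cos a *: w.2 - sin a *: w.1).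

Lemma rotateD a b w : rotate a (rotate b w) = rotate (a + b) w.
Proof.
by congr (_, _); apply/rowP => i; rewrite /= !mxE cosD sinD; ring.
Qed.

Definition orthonormal_pair w :=
  [/\ dot w.1 w.1 = 1, dot w.2 w.2 = 1 & dot w.1 w.2 = 0].

Lemma rotate_orthonormal a w :
  orthonormal_pair w -> orthonormal_pair (rotate a w).
Proof.
move=> [w1 w2 w12]; have cs := cos2Dsin2 a.
split; rewrite /= !(dotDl, dotDr, dotNl, dotNr, dotZl, dotZr);
  rewrite (dotC w.2) ?w12 w1 w2.
- by rewrite -[RHS]cs; ring.
- by rewrite -[RHS]cs; ring.
- by ring.
Qed.

(** Angular velocities add: the pair [(r, s)] already turns at speed [k], and the rotation
    contributes [dth]. *)
Lemma is_derive_rotate (th : R -> R) (dth k : R) (r s : R -> 'rV[R]_n) (t : R) :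
  is_derive t 1 th dth ->
  is_derive t 1 r (k *: s t) -> is_derive t 1 s (- k *: r t) ->
  is_derive t 1 (fun x => (rotate (th x) (r x, s x)).1)
    ((dth + k) *: (rotate (th t) (r t, s t)).2) /\
  is_derive t 1 (fun x => (rotate (th x) (r x, s x)).2)
    (- (dth + k) *: (rotate (th t) (r t, s t)).1).
Proof.
move=> dth' dr ds.
have dc : is_derive t 1 (fun x => cos (th x)) (- sin (th t) * dth).
  exact: is_derive1_comp.
have dsi : is_derive t 1 (fun x => sin (th x)) (cos (th t) * dth).
  exact: is_derive1_comp.
have dcr := is_derive_scalemx dc dr.
have dcs := is_derive_scalemx dc ds.
have dsr := is_derive_scalemx dsi dr.
have dss := is_derive_scalemx dsi ds.
split.
  apply: (is_derive_eq (is_deriveD dcr dss)).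
  by apply/rowP => i; rewrite /= !mxE; ring.
apply: (is_derive_eq (is_deriveB dcs dsr)).
by apply/rowP => i; rewrite /= !mxE; ring.
Qed.

End rotation.

(** The curve is a great circle of unit speed: its acceleration [- x] is normal to the sphere, so
    the tangential part vanishes. *)
Lemma unit_geodesic_rotate (R : realType) (w : 'rV[R]_4 * 'rV[R]_4) :
  orthonormal_pair w ->
  unit_geodesic (fun u => (rotate u w).1) (fun u => (rotate u w).2).
Proof.
move=> wo u; have [x1 y1 xy0] := rotate_orthonormal u wo.
(* A constant pair has [k = 0], and the angle [id] has speed 1. *)
have [] := @is_derive_rotate _ _ id 1 0 (cst w.1) (cst w.2) u _ _ _.
- by rewrite scale0r; exact: is_derive_cst.
- by rewrite oppr0 scale0r; exact: is_derive_cst.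
rewrite addr0 scale1r scaleN1r -surjective_pairing => dx [dy dyE].
split=> //.
  by rewrite /T1S3 /TS3 /enorm /= x1 y1 sqrtr1.
by rewrite dyE /tangent_proj dotNr x1 scaleN1r opprK addrC subrr.
Qed.

(** * The orthonormal frame [(r, s)] and its relation to the energy *)

Section ligon_schaaf_frame.
Context {R : realType}.
Implicit Types (q p : 'rV[R]_3) (nu : R).

(* nu is an independent parameter here, since kepler_nu is known to be constant
   along the orbit only on J. *)
Definition ls_r nu q p : 'rV[R]_4 :=
  vec4 (enorm p ^+ 2 * enorm q - 1) ((nu * enorm q) *: p).

Definition ls_s nu q p : 'rV[R]_4 :=
  vec4 (- (nu * dot q p)) (- ((enorm q)^-1 *: q - dot q p *: p)).

(** The angle [- s_0] in the matrix of [ls_R] is the angle [s_0] in the orientation of [rotate]; the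
    division by [nu] affects only the second row. *)
Lemma ligon_schaaf_rotate q p (nu := kepler_nu q p) :
  let w := rotate (- (nu * dot q p)) (ls_r nu q p, ls_s nu q p) in
  ligon_schaaf q p = (w.1, nu^-1 *: w.2).
Proof.
rewrite /ligon_schaaf /ls_R /ls_S -/nu /=.
rewrite (_ : vec4 _ _ 0 ord0 = - (nu * dot q p)); last first.
  rewrite (_ : ord0 = @lshift 1 3 0) ?vec4El//; exact: val_inj.
rewrite -/(ls_r nu q p) -/(ls_s nu q p) cosN sinN; congr (_, _).
  by rewrite scaleNr opprK.
by rewrite scalerBr !scalerA addrC mulNr scaleNr ![_^-1 * _]mulrC.
Qed.

Lemma kepler_nu_gt0 q p : kepler_H q p < 0 -> 0 < kepler_nu q p.
Proof. by move=> H0; rewrite sqrtr_gt0 -mulrN mulr_gt0// oppr_gt0. Qed.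

(** Energy relation solved for |p|^2. Negativity of [kepler_H] ensures that [kepler_nu] squares to
    -2H, as [Num.sqrt] is 0 on negative numbers. *)
Lemma dot_momentum q p :
  kepler_H q p < 0 -> dot p p = 2 / enorm q - kepler_nu q p ^+ 2.
Proof.
move=> H0; rewrite sqr_sqrtr; last by rewrite -mulrN mulr_ge0// oppr_ge0 ltW.
(* Naming the inverse keeps [field] from asking for [enorm q != 0]. *)
rewrite /kepler_H sqr_enorm; by set i := (enorm q)^-1; field.
Qed.

(** Since a = nu^(-2), the mean motion a^(-3/2) is nu^3. *)
Lemma mean_anomalyE (q p : R -> 'rV[R]_3) (tau t : R) :
  kepler_H (q t) (p t) < 0 ->
  mean_anomaly tau q p t = kepler_nu (q t) (p t) ^+ 3 * (t - tau).
Proof.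
move=> H0; rewrite /mean_anomaly; congr (_ * _).
have nu0 := kepler_nu_gt0 H0.
have -> : semi_major_axis (q t) (p t) = kepler_nu (q t) (p t) `^ (- 2).
  rewrite powRN (powR_mulrn 2) ?ltW// sqr_sqrtr ?invrN//.
  by rewrite -mulrN mulr_ge0// oppr_ge0 ltW.
rewrite -powRrM (_ : - 2 * _ = 3); last by field.
by rewrite (powR_mulrn 3)// ltW.
Qed.

(** All products reduce to |q|, <q,p> and |p|^2; the energy relation eliminates the last. *)
Lemma ls_orthonormal q p (nu := kepler_nu q p) :
  q != 0 -> kepler_H q p < 0 -> orthonormal_pair (ls_r nu q p, ls_s nu q p).
Proof.
move=> q0 H0; have := dot_momentum H0; rewrite -/nu => pp.
have rho0 : enorm q != 0 by rewrite lt0r_neq0// enorm_gt0.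
have qq := esym (sqr_enorm q).
split; rewrite /= /ls_r /ls_s dot_vec4 ?sqr_enorm;
  rewrite !(dotDl, dotDr, dotNl, dotNr, dotZl, dotZr) ?(dotC p q) ?qq pp;
  by field.
Qed.

End ligon_schaaf_frame.

(** * Derivatives along the Kepler flow *)

Section kepler_flow.
Context {R : realType} (q p : R -> 'rV[R]_3) (t : R).
Hypothesis q0 : q t != 0.
Hypothesis dq : is_derive t 1 q (p t).
Hypothesis dp : is_derive t 1 p (- ((enorm (q t) ^+ 3)^-1 *: q t)).

Let rho0 : enorm (q t) != 0.
Proof. by rewrite lt0r_neq0// enorm_gt0. Qed.

Lemma is_derive_kepler_H : is_derive t 1 (fun x => kepler_H (q x) (p x)) 0.
Proof.
have drho := is_derive_enorm q0 dq.
have dpp := is_derive_dot dp dp.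
(* |p|^2 is differentiated as [dot p p], because [enorm] may fail to be differentiable where [p]
   vanishes. *)
rewrite (_ : (fun x => _) = (2^-1 *: (fun x => dot (p x) (p x)))
    - (fun x => (enorm (q x))^-1)); last first.
  by apply/funext => x; rewrite /kepler_H sqr_enorm mulrC.
have dV := is_deriveV (f := fun x => enorm (q x)) rho0 drho.
apply: is_derive_eq; rewrite !(dotNl, dotNr, dotZl, dotZr) (dotC (p t)).
by rewrite /GRing.scale/=; field.
Qed.

(** Lagrange-Jacobi identity; combined with the energy relation it yields the derivative of
    [s_0]. *)
Lemma is_derive_dot_kepler :
  is_derive t 1 (fun x => dot (q x) (p x)) (dot (p t) (p t) - (enorm (q t))^-1).
Proof.
apply: (is_derive_eq (is_derive_dot dq dp)).
by rewrite dotNr dotZr -(sqr_enorm (q t)); field.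
Qed.

(** The speed nu/|q| is that of the eccentric anomaly. The energy relation enters in [r_0] and in
    the vector part of [s]; the other two parts follow from the equations of motion alone. *)
Lemma is_derive_ls (nu : R) :
  dot (p t) (p t) = 2 / enorm (q t) - nu ^+ 2 ->
  is_derive t 1 (fun x => ls_r nu (q x) (p x))
    ((nu / enorm (q t)) *: ls_s nu (q t) (p t)) /\
  is_derive t 1 (fun x => ls_s nu (q x) (p x))
    (- (nu / enorm (q t)) *: ls_r nu (q t) (p t)).
Proof.
move=> pp.
have drho := is_derive_enorm q0 dq.
have dpp := is_derive_dot dp dp.
have dqp := is_derive_dot_kepler.
have dV := is_deriveV (f := fun x => enorm (q x)) rho0 drho.
rewrite /ls_r /ls_s !scale_vec4; split.
  have dr0 : is_derive t 1 (fun x => enorm (p x) ^+ 2 * enorm (q x) - 1)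
      (nu / enorm (q t) * - (nu * dot (q t) (p t))).
    rewrite (_ : (fun x => _) = (fun x => dot (p x) (p x)) *
        (fun x => enorm (q x)) - cst 1); last first.
      by apply/funext => x; rewrite sqr_enorm.
    apply: is_derive_eq.
    rewrite /GRing.scale/= dotNl dotNr !dotZl !dotZr (dotC (p t)) pp.
    by field.
  apply: is_derive_vec4 => //.
  have := is_derive_scalemx (is_deriveZ nu drho) dp.
  move/is_derive_eq; apply; apply/rowP => i; rewrite !mxE /= /GRing.scale/=.
  by field.
have ds0 : is_derive t 1 (fun x => - (nu * dot (q x) (p x)))
    (- (nu / enorm (q t)) * (enorm (p t) ^+ 2 * enorm (q t) - 1)).
  apply: (is_derive_eq (is_deriveN (is_deriveZ nu dqp))).
  by rewrite sqr_enorm /GRing.scale/=; field.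
apply: is_derive_vec4 => //.
have d1 := is_derive_scalemx dV dq.
have d2 := is_derive_scalemx dqp dp.
apply: (is_derive_eq (is_deriveN (is_deriveB d1 d2))).
apply/rowP => i; rewrite !mxE /GRing.scale/= pp.
by field.
Qed.

End kepler_flow.

(* phi maps into T^*S^3 minus the zero section, which is identified with
   T_1^*S^3 x R_{>0} by ((x, y), nu) |-> (x, y / nu). *)
Theorem theorem4p12 (R : realType) (J : set R) (q p : R -> 'rV[R]_3) (tau : R) :
  kepler_orbit J q p ->
  (forall t, J t -> Sigma_minus (q t, p t)) ->
  periapsis_time J q tau ->
  exists x y : R -> 'rV[R]_4,
    unit_geodesic x y /\
    forall t, J t ->
      let M := mean_anomaly tau q p t in
      ligon_schaaf (q t) (p t) = (x M, (kepler_nu (q t) (p t))^-1 *: y M).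
Proof.
move=> [_ Jitv orb] Sig peri.
(* If [tau] is not in [J], it lies in the closure of [J], which forces [J] to be inhabited. *)
have [t0 Jt0] : J !=set0.
  case: peri => [[Jtau _]|[_ /(_ setT filterT)[t []]]]; first by exists tau.
  by exists t.
have H0 t : J t -> kepler_H (q t) (p t) < 0 by move/Sig => [].
pose nu := kepler_nu (q t0) (p t0).
have nuE t : J t -> kepler_nu (q t) (p t) = nu.
  move=> Jt; rewrite /nu /kepler_nu.
  rewrite (@derive0_interval_cst _ J (fun x => kepler_H (q x) (p x)) _ _ t t0)//.
  by move=> x /orb[*]; exact: is_derive_kepler_H.
pose s0 t := - (nu * dot (q t) (p t)).
(* [beta] is [s_0] minus the mean anomaly; by Kepler's equation it decreases at the rate nu/|q| of
   the eccentric anomaly, which cancels the turning of the frame in [W]. *)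
pose beta t := s0 t - nu ^+ 3 * (t - tau).
pose W t := rotate (beta t) (ls_r nu (q t) (p t), ls_s nu (q t) (p t)).
have dW t : J t -> is_derive t 1 (fun x => (W x).1) 0 /\
                   is_derive t 1 (fun x => (W x).2) 0.
  move=> Jt; have [q0 dq dp] := orb t Jt.
  have pp := dot_momentum (H0 t Jt); rewrite nuE// in pp.
  have rho0 : enorm (q t) != 0 by rewrite lt0r_neq0// enorm_gt0.
  have [dr ds] := is_derive_ls q0 dq dp pp.
  have dbeta : is_derive t 1 beta (- (nu / enorm (q t))).
    have dqp := is_derive_dot_kepler q0 dq dp.
    have dM := is_deriveZ (nu ^+ 3)
      (is_deriveB (is_derive_id t 1) (is_derive_cst tau t 1)).
    apply: (is_derive_eq (is_deriveB (is_deriveN (is_deriveZ nu dqp)) dM)).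
    by rewrite pp /GRing.scale/=; field.
  have := is_derive_rotate dbeta dr ds.
  by rewrite addNr oppr0 !scale0r.
have WE t : J t -> W t = W t0.
  move=> Jt; rewrite [LHS]surjective_pairing [RHS]surjective_pairing.
  congr (_, _); apply/rowP => i.
    apply: (@derive0_interval_cst _ J (fun x => (W x).1 0 i)) => // x /dW[+ _].
    by move=> /is_derive_mxP/(_ 0 i); rewrite mxE.
  apply: (@derive0_interval_cst _ J (fun x => (W x).2 0 i)) => // x /dW[_].
  by move=> /is_derive_mxP/(_ 0 i); rewrite mxE.
(* The great circle through the constant pair [W t0], defined for all [u]. Turning [W t] by the mean
   anomaly restores the angle [s_0], hence the Ligon-Schaaf image. *)
exists (fun u => (rotate u (W t0)).1), (fun u => (rotate u (W t0)).2); split.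
  apply/unit_geodesic_rotate/rotate_orthonormal.
  by apply: ls_orthonormal; [case/orb: Jt0|exact: H0].
move=> t Jt M; rewrite /M mean_anomalyE ?H0// ligon_schaaf_rotate nuE//.
by rewrite -(WE t Jt) /W rotateD /beta addrC subrK.
Qed.
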